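(* Let six points $a, b, c, a_1, b_1, k$ and three concurrent lines $A, B, C$ in $\mathbb{P}^2$ be given, defining the cubic $$(xaAa_1\,.\,xbBkCb_1\,.\,xc)=0 .$$ Then the tangent to the cubic at the point $a$ is $$(abBkCb_1\,.\,ac)\,a_1\,A\,a ,$$ that is, setting $p$ equal to the meet of the lines $abBkCb_1$ and $ac$, the tangent line at $a$ is the join of $a$ with the meet of the line $pa_1$ with the line $A$.
   Context: Work in the projective plane $\mathbb{P}^2$. Points are nonzero vectors $[x_0:x_1:x_2]$ up to scaling; a line $L_0x_0+L_1x_1+L_2x_2=0$ is represented by its coefficient vector $[L_0:L_1:L_2]$ up to scaling. A zero point $[0:0:0]$ and a zero line $[0:0:0]$ are allowed as degenerate values. Lower case letters denote points, upper case letters denote lines. The join of points $p,q$ is the line $pq:=p\times q$ (cross product), and the meet of lines $L,M$ is the point $LM:=L\times M$ (so $pp$ and $LL$ are zero). If $L$ is a line and $r$ a point, $Lr$ is a scalar that vanishes when $r$ lies on $L$. For three points, or three lines, the bracket is $(u.v.w)=u\cdot(v\times w)$; only its vanishing matters. Expressions are evaluated from left to right, with periods (and parentheses) separating factors that are evaluated first: for example $xaAa_1$ is the line joining $a_1$ to the meet of the line $xa$ with $A$; $xbBkCb_1=((((xb)B)k)C)b_1$ is a line; and $pq.rs$ denotes the meet of the lines $pq$ and $rs$. The expression $F(x)=(xaAa_1.xbBkCb_1.xc)$, computed with fixed vector representatives, is a homogeneous cubic form in $x=(x_0,x_1,x_2)$; the cubic is its zero set, and it contains $a$. A line $av$ through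 $a$ is a tangent line to the cubic at $a$ when the coefficient of $\epsilon$ in the expansion of $F(a+\epsilon v)$ vanishes. *)

(* Defs.v *)
From HB Require Import structures.
From mathcomp Require Import all_boot all_order all_algebra.

Set Implicit Arguments.
Unset Strict Implicit.
Unset Printing Implicit Defensive.
Import GRing.Theory.
Local Open Scope ring_scope.

(* Points and lines of P^2 are both given by homogeneous coordinates, i.e. by
   row vectors of length 3; the zero vector is the degenerate point or line.
   The algebraic operations are defined over any commutative ring so that they
   can also be evaluated at vectors with coefficients in K[eps]. *)

(* Indices live in 'I_3, where i + 1 and i + 2%:R are taken modulo 3. *)
Definition crossmul (R : comNzRingType) (u v : 'rV[R]_3) : 'rV[R]_3 :=
  \row_(i < 3) (u 0 (i + 1) * v 0 (i + 2%:R) - u 0 (i + 2%:R) * v 0 (i + 1)).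

(* Join of two points and meet of two lines; left associative, so that
   x *v a *v A *v a1 is the expression written xaAa_1. *)
Notation "u *v w" := (crossmul u w) (at level 40, left associativity).

Definition dotmul (R : comNzRingType) (u v : 'rV[R]_3) : R :=
  \sum_(i < 3) u 0 i * v 0 i.

Definition bracket (R : comNzRingType) (u v w : 'rV[R]_3) : R :=
  dotmul u (v *v w).

(* F(x) = (xaAa_1 . xbBkCb_1 . xc) *)
Definition cubic_form (R : comNzRingType)
    (a b c a1 b1 k A B C x : 'rV[R]_3) : R :=
  bracket (x *v a *v A *v a1) (x *v b *v B *v k *v C *v b1) (x *v c).

Definition incident (K : fieldType) (L r : 'rV[K]_3) : Prop :=
  dotmul L r = 0.

Definition concurrent (K : fieldType) (A B C : 'rV[K]_3) : Prop :=
  exists p : 'rV[K]_3,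
    [/\ p != 0, incident A p, incident B p & incident C p].

(* Equality of homogeneous coordinates up to scaling. *)
Definition proj_eq (K : fieldType) (u v : 'rV[K]_3) : Prop :=
  exists2 s : K, s != 0 & u = s *: v.

(* F(a + eps v) as an element of K[eps], with eps = 'X. *)
Definition cubic_expansion (K : fieldType)
    (a b c a1 b1 k A B C v : 'rV[K]_3) : {poly K} :=
  let emb := map_mx (polyC : K -> {poly K}) in
  cubic_form (emb a) (emb b) (emb c) (emb a1) (emb b1) (emb k)
             (emb A) (emb B) (emb C) (emb a + 'X *: emb v).

(* L is a line av through a such that the coefficient of eps in F(a + eps v)
   vanishes. *)
Definition is_tangent_at_a (K : fieldType)
    (a b c a1 b1 k A B C L : 'rV[K]_3) : Prop :=
  L != 0 /\
  exists v : 'rV[K]_3,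
    proj_eq L (a *v v) /\ (cubic_expansion a b c a1 b1 k A B C v)`_1 = 0.

(* Main.v *)
Require Import Defs.
From HB Require Import structures.
From mathcomp Require Import all_boot all_order all_algebra.
From mathcomp Require Import ring.

Set Implicit Arguments.
Unset Strict Implicit.
Unset Printing Implicit Defensive.
Import GRing.Theory.
Local Open Scope ring_scope.

(** Since [(a + eps v) a = eps (v a)], the first factor of [F(a + eps v)] is
    divisible by [eps], so the coefficient of [eps] is
    [(v a A a1 . a b B k C b1 . a c) = (v a A a1) p]; by the scalar triple
    product identity this equals [v T] up to sign.  Hence [av] is tangent exactly
    when [v] lies on [T], which is itself a line through [a]. *)

Section CrossProduct.
Variable R : comNzRingType.
Implicit Types (s : R) (u v w z : 'rV[R]_3).

Lemma forall_I3 (P : 'I_3 -> Prop) :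
  P 0 -> P 1 -> P 2%:R -> forall i, P i.
Proof.
move=> P0 P1 P2 [[|[|[|//]]] lt_i3].
- by rewrite (_ : Ordinal _ = 0) //; apply: val_inj.
- by rewrite (_ : Ordinal _ = 1) //; apply: val_inj.
- by rewrite (_ : Ordinal _ = 2%:R) //; apply: val_inj.
Qed.

Lemma rV3P u v :
  u 0 0 = v 0 0 -> u 0 1 = v 0 1 -> u 0 2%:R = v 0 2%:R -> u = v.
Proof. by move=> e0 e1 e2; apply/rowP; apply: forall_I3. Qed.

(** A tuple of equations serves as one rewrite rule for all coordinates; with [rV3P] it reduces
    vector identities to [ring]. *)
Lemma crossmulE u v :
  ((u *v v) 0 0 = u 0 1 * v 0 2%:R - u 0 2%:R * v 0 1) *
  ((u *v v) 0 1 = u 0 2%:R * v 0 0 - u 0 0 * v 0 2%:R) *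
  ((u *v v) 0 2%:R = u 0 0 * v 0 1 - u 0 1 * v 0 0).
Proof.
have e11 : 1 + 1 = 2%:R :> 'I_3 by apply: val_inj.
have e12 : 1 + 2%:R = 0 :> 'I_3 by apply: val_inj.
have e21 : 2%:R + 1 = 0 :> 'I_3 by apply: val_inj.
have e22 : 2%:R + 2%:R = 1 :> 'I_3 by apply: val_inj.
by rewrite !mxE !add0r e11 e12 e21 e22.
Qed.

Lemma dotmulE u v :
  dotmul u v = u 0 0 * v 0 0 + u 0 1 * v 0 1 + u 0 2%:R * v 0 2%:R.
Proof.
rewrite /dotmul !big_ord_recl big_ord0 addr0 addrA.
have -> : lift ord0 ord0 = 1 :> 'I_3 by apply: val_inj.
by have -> : lift ord0 (lift ord0 ord0) = 2%:R :> 'I_3 by apply: val_inj.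
Qed.

Lemma crossmulvv u : u *v u = 0.
Proof. by apply: rV3P; rewrite !crossmulE !mxE; ring. Qed.

Lemma crossmulDl u v w : (u + v) *v w = u *v w + v *v w.
Proof. by apply: rV3P; rewrite !(crossmulE, mxE); ring. Qed.

Lemma crossmulZl s u v : (s *: u) *v v = s *: (u *v v).
Proof. by apply: rV3P; rewrite !(crossmulE, mxE); ring. Qed.

Lemma crossmulC u v : u *v v = - (v *v u).
Proof. by apply: rV3P; rewrite !(crossmulE, mxE); ring. Qed.

Lemma dotmulC u v : dotmul u v = dotmul v u.
Proof. by rewrite !dotmulE; ring. Qed.

Lemma dotmulZl s u v : dotmul (s *: u) v = s * dotmul u v.
Proof. by rewrite !dotmulE !mxE; ring. Qed.

Lemma dotmul0l v : dotmul 0 v = 0.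
Proof. by rewrite dotmulE !mxE; ring. Qed.

Lemma dotmul_crossmull u v : dotmul u (u *v v) = 0.
Proof. by rewrite dotmulE !crossmulE; ring. Qed.

Lemma dotmul_crossmulr u v : dotmul v (u *v v) = 0.
Proof. by rewrite dotmulE !crossmulE; ring. Qed.

Lemma crossmul_crossmul u v w :
  u *v (v *v w) = dotmul u w *: v - dotmul u v *: w.
Proof. by apply: rV3P; rewrite !(crossmulE, dotmulE, mxE); ring. Qed.

Lemma dotmul_crossmulA u v w : dotmul (u *v v) w = dotmul u (v *v w).
Proof. by rewrite !dotmulE !crossmulE; ring. Qed.

Lemma dotmulNr u v : dotmul u (- v) = - dotmul u v.
Proof. by rewrite !dotmulE !mxE; ring. Qed.

Lemma crossmulNl u v : - u *v v = - (u *v v).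
Proof. by rewrite -!scaleN1r crossmulZl. Qed.

(** Right multiplication by a fixed vector is skew-adjoint for [dotmul]; moving three of them across
    reverses their order and leaves one sign. *)
Lemma dotmul_crossmul_adjoint u v w z p :
  dotmul (u *v v *v w *v z) p = - dotmul u (p *v z *v w *v v).
Proof.
rewrite !dotmul_crossmulA (crossmulC z p) (crossmulC w) crossmulNl opprK.
by rewrite crossmulC dotmulNr.
Qed.

End CrossProduct.

Section Morphism.
Variables (R S : comNzRingType) (f : {rmorphism R -> S}).
Implicit Types u v w : 'rV[R]_3.

Lemma map_crossmul u v : map_mx f (u *v v) = map_mx f u *v map_mx f v.
Proof. by apply/rowP => i; rewrite !mxE rmorphB !rmorphM. Qed.

Lemma rmorph_dotmul u v : f (dotmul u v) = dotmul (map_mx f u) (map_mx f v).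
Proof.
by rewrite rmorph_sum; apply: eq_bigr => i _; rewrite rmorphM !mxE.
Qed.

Lemma rmorph_bracket u v w :
  f (bracket u v w) = bracket (map_mx f u) (map_mx f v) (map_mx f w).
Proof. by rewrite rmorph_dotmul map_crossmul. Qed.

End Morphism.

Section Tangent.
Variable K : fieldType.
Implicit Types u v w L : 'rV[K]_3.

Lemma exists_dotmul1 u : u != 0 -> exists w, dotmul w u = 1.
Proof.
case/rV0Pn => i ui0; exists ((u 0 i)^-1 *: delta_mx 0 i).
rewrite dotmulZl /dotmul (bigD1 i) //= big1 => [|j /negbTE ij].
  by rewrite mxE !eqxx mul1r addr0 mulVf.
by rewrite mxE ij andbF mul0r.
Qed.

(** Pick [w] with [w . v = 1]. Expanding [w *v (u *v v) = 0] by the vector triple product identity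
    gives [u = (w . u) v], and the scalar is nonzero because [u] is. *)
Lemma crossmul_eq0_proj_eq u v :
  u != 0 -> v != 0 -> u *v v = 0 -> proj_eq u v.
Proof.
move=> u0 v0 uv0; have [w wv1] := exists_dotmul1 v0.
have uE : u = dotmul w u *: v.
  apply/eqP; rewrite -subr_eq0 -[X in X - _]scale1r -wv1.
  rewrite -crossmul_crossmul uv0.
  by apply/eqP/rV3P; rewrite !crossmulE !mxE; ring.
exists (dotmul w u) => //; apply: contraNneq u0 => wu0.
by rewrite uE wu0 scale0r.
Qed.

Lemma incident_crossmul u L :
  u != 0 -> incident L u -> exists v, L = u *v v.
Proof.
move=> u0 Lu0; have [w wu1] := exists_dotmul1 u0.
(* The witness is the meet of [L] with a line [w] missing [u]; normalizing [w . u = 1] makes the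
   join with [u] equal to [L] exactly, not just up to scale. *)
exists (L *v w); rewrite crossmul_crossmul (dotmulC u w) wu1 scale1r.
by rewrite dotmulC Lu0 scale0r subr0.
Qed.

Lemma cubic_expansion_coef1 a b c a1 b1 k A B C v :
  let p := (a *v b *v B *v k *v C *v b1) *v (a *v c) in
  (cubic_expansion a b c a1 b1 k A B C v)`_1 =
  - dotmul v (p *v a1 *v A *v a).
Proof.
(* Evaluation at [eps = 0] is a ring morphism, so it passes through every join, meet and bracket. *)
pose ev0 := [the {rmorphism {poly K} -> K} of horner_eval (0 : K)].
have ev0C u : map_mx ev0 (map_mx polyC u) = u.
  by apply/rowP => i; rewrite !mxE /= /horner_eval hornerC.
have ev0D u w : map_mx ev0 (map_mx polyC u + 'X *: map_mx polyC w) = u.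
  by apply/rowP => i; rewrite !mxE /= /horner_eval !hornerE
    ?(mul0r, mulr0, addr0).
(* Only the join of [x] with [a] is expanded: it pulls out one factor ['X], so the coefficient
   sought is the constant term of the cofactor, where [x] may be replaced by [a]. *)
rewrite /cubic_expansion /cubic_form {1}(crossmulDl _ _ (map_mx polyC a)).
rewrite crossmulvv add0r !crossmulZl /bracket dotmulZl coefXM /=.
rewrite -horner_coef0 -[LHS]/(ev0 _) -/(bracket _ _ _) rmorph_bracket.
by rewrite /bracket !map_crossmul !ev0D !ev0C dotmul_crossmul_adjoint.
Qed.

End Tangent.

Theorem theorem4p3 (K : fieldType) (a b c a1 b1 k A B C : 'rV[K]_3)
    (ha : a != 0) (hb : b != 0) (hc : c != 0)
    (ha1 : a1 != 0) (hb1 : b1 != 0) (hk : k != 0)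
    (hA : A != 0) (hB : B != 0) (hC : C != 0)
    (hABC : concurrent A B C) :
  let p := (a *v b *v B *v k *v C *v b1) *v (a *v c) in
  let T := p *v a1 *v A *v a in
  (T != 0 -> forall L : 'rV[K]_3,
     is_tangent_at_a a b c a1 b1 k A B C L <-> proj_eq L T) /\
  (T = 0 -> forall L : 'rV[K]_3, L != 0 -> incident L a ->
     is_tangent_at_a a b c a1 b1 k A B C L).
Proof.
move=> p T; have coef1E v :
    (cubic_expansion a b c a1 b1 k A B C v)`_1 = - dotmul v T.
  exact: cubic_expansion_coef1.
split=> [T0 L | T0 L L0 La]; last first.
  (* When [T = 0] the coefficient vanishes for every [v], so it is enough to write [L] as a join
     with [a]. *)
  split=> //; have [v ->] := incident_crossmul ha La.
  exists v; split; last by rewrite coef1E T0 dotmulC dotmul0l oppr0.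
  by exists 1; rewrite ?oner_neq0 ?scale1r.
split=> [[L0 [v [[s s0 LE]]]] | [s s0 ->]].
  rewrite coef1E => /eqP; rewrite oppr_eq0 => /eqP vT.
  apply: crossmul_eq0_proj_eq => //.
  (* Up to sign, [T *v (a *v v)] is a combination of [a] and [v] with coefficients [T . v], zero by
     tangency, and [T . a], zero because [T] is a join with [a]. *)
  rewrite LE crossmulZl crossmulC crossmul_crossmul (dotmulC T v) vT.
  by rewrite dotmulC dotmul_crossmulr !scale0r subrr oppr0 scaler0.
split; first by rewrite scaler_eq0 negb_or s0.
(* Take for [v] the meet of [p a1] with [A], which lies on [T]. Since [T] is [v *v a] rather than
   [a *v v], the scale becomes [- s]. *)
exists (p *v a1 *v A); split; last by rewrite coef1E dotmul_crossmull oppr0.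
by exists (- s); rewrite ?oppr_eq0 // (crossmulC a) scalerN scaleNr opprK.
Qed.
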